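(* $$\pi=\sum_{n=0}^{\infty}\frac{(-1)^n}{4^n}\left[\frac{2}{4n+1}+\frac{2}{4n+2}+\frac{1}{4n+3}\right].$$ *)

(* Defs.v *)
From Stdlib Require Export Reals.
From Coquelicot Require Export Coquelicot.

(* Main.v *)
Require Import Defs.
From Stdlib Require Import Reals Lra Lia.
From Coquelicot Require Import Coquelicot.
Open Scope R_scope.

(** Sophie Germain's factorisation
    [y^4 + 4 = (y^2 + 2 y + 2) (y^2 - 2 y + 2)] turns [4 / (1 + (y - 1)^2)]
    into [(2 + 2 y + y^2) / (1 + y^4 / 4)], a geometric series of ratio
    [- y^4 / 4] multiplied by a quadratic.  Integrating from 0 to 1, the left
    side gives [4 (atan 0 - atan (-1)) = PI] and the [n]-th term on the right
    gives the [n]-th summand of the series.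

    The interchange of sum and integral is replaced by an exact remainder.
    Subtracting from [4 atan (y - 1)] the antiderivatives of the first [N + 1]
    terms leaves a function whose derivative is a single product
    ([is_derive_remainder]); on the unit interval this derivative is at most
    [(1/4)^N] in absolute value, so the mean value theorem puts the [N]-th partial sum within
    [(1/4)^N] of [PI] ([partial_sum_error]). *)

Definition term_primitive (n : nat) (y : R) : R :=
  (-1) ^ n / 4 ^ n *
  (2 * y ^ (4 * n + 1) / (4 * INR n + 1) +
   2 * y ^ (4 * n + 2) / (4 * INR n + 2) +
   y ^ (4 * n + 3) / (4 * INR n + 3)).

Lemma is_derive_pow_over (k : nat) (c y : R) :
  c = INR (S k) -> is_derive (fun y => y ^ S k / c) y (y ^ k).
Proof.
  intros ->.
  assert (Hk : INR (S k) <> 0) by (apply not_0_INR; lia).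
  auto_derive; [trivial|].
  change (Init.Nat.pred (S k)) with k.
  field; exact Hk.
Qed.

Lemma is_derive_term_primitive (n : nat) (y : R) :
  is_derive (term_primitive n) y ((- y ^ 4 / 4) ^ n * (2 + 2 * y + y ^ 2)).
Proof.
  assert (Hc : forall j, 4 * INR n + INR (S j) = INR (S (4 * n + j))).
  { intros j. rewrite !S_INR, plus_INR, mult_INR. simpl. lra. }
  assert (H1 : is_derive (fun y => y ^ S (4 * n + 0) / (4 * INR n + 1)) y
                 (y ^ (4 * n + 0))) by (apply is_derive_pow_over, (Hc 0%nat)).
  assert (H2 : is_derive (fun y => y ^ S (4 * n + 1) / (4 * INR n + 2)) y
                 (y ^ (4 * n + 1))) by (apply is_derive_pow_over, (Hc 1%nat)).
  assert (H3 : is_derive (fun y => y ^ S (4 * n + 2) / (4 * INR n + 3)) y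
                 (y ^ (4 * n + 2))).
  { apply is_derive_pow_over. rewrite <- Hc. simpl. lra. }
  apply (is_derive_scal _ _ 2) in H1.
  apply (is_derive_scal _ _ 2) in H2.
  pose proof (is_derive_plus _ _ _ _ _ (is_derive_plus _ _ _ _ _ H1 H2) H3) as H.
  apply (is_derive_scal _ _ ((-1) ^ n / 4 ^ n)) in H.
  replace ((- y ^ 4 / 4) ^ n * (2 + 2 * y + y ^ 2)) with
    ((-1) ^ n / 4 ^ n *
     (2 * y ^ (4 * n + 0) + 2 * y ^ (4 * n + 1) + y ^ (4 * n + 2))).
  - revert H. apply is_derive_ext. intros t. unfold term_primitive.
    change (@plus _) with Rplus. cbv beta. rewrite !plus_n_Sm.
    (* The equation is stated in the carrier of a normed module. *)
    lazymatch goal with |- ?a = ?b => change (@eq R a b) end.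
    unfold Rdiv. ring.
  - replace (- y ^ 4 / 4) with ((-1) * y ^ 4 * / 4) by field.
    rewrite !Rpow_mult_distr, pow_inv, !pow_add, <- pow_mult.
    unfold Rdiv. ring.
Qed.

Definition remainder (N : nat) (y : R) : R :=
  4 * atan (y - 1) - sum_n (fun n => term_primitive n y) N.

Lemma shifted_square_pos (y : R) : 0 < 1 + (y - 1) ^ 2.
Proof. nra. Qed.

(** [4 / (1 + (y - 1)^2)] minus the first [N + 1] terms of its expansion: the
    tail of a geometric series is its sum times a power of the ratio. *)
Lemma is_derive_remainder (N : nat) (y : R) :
  is_derive (remainder N) y (4 / (1 + (y - 1) ^ 2) * (- y ^ 4 / 4) ^ S N).
Proof.
  pose proof (shifted_square_pos y) as Hq.
  (* Removing the term of index n from the tail starting at r^n. *)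
  assert (Hstep : forall n f,
    is_derive f y (4 / (1 + (y - 1) ^ 2) * (- y ^ 4 / 4) ^ n) ->
    is_derive (fun y => f y - term_primitive n y) y
      (4 / (1 + (y - 1) ^ 2) * (- y ^ 4 / 4) ^ S n)).
  { intros n f Hf.
    pose proof (is_derive_minus _ _ _ _ _ Hf (is_derive_term_primitive n y)) as H.
    replace (4 / (1 + (y - 1) ^ 2) * (- y ^ 4 / 4) ^ S n) with
      (minus (4 / (1 + (y - 1) ^ 2) * (- y ^ 4 / 4) ^ n)
         ((- y ^ 4 / 4) ^ n * (2 + 2 * y + y ^ 2))); [exact H|].
    change (4 / (1 + (y - 1) ^ 2) * (- y ^ 4 / 4) ^ n -
            (- y ^ 4 / 4) ^ n * (2 + 2 * y + y ^ 2) =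
            4 / (1 + (y - 1) ^ 2) * (- y ^ 4 / 4 * (- y ^ 4 / 4) ^ n)).
    generalize ((- y ^ 4 / 4) ^ n); intros r. field. lra. }
  induction N as [|N IH].
  - apply (is_derive_ext (fun y => 4 * atan (y - 1) - term_primitive 0 y)).
    { intros t. unfold remainder. now rewrite sum_O. }
    apply (Hstep 0%nat (fun y => 4 * atan (y - 1))).
    auto_derive; [trivial|]. simpl. field. simpl in Hq. lra.
  - apply (is_derive_ext (fun y => remainder N y - term_primitive (S N) y)).
    { intros t. unfold remainder. rewrite sum_Sn.
      symmetry. apply Rminus_plus_distr. }
    apply Hstep, IH.
Qed.

Lemma remainder_derivative_bound (N : nat) (y : R) :
  0 <= y <= 1 ->
  Rabs (4 / (1 + (y - 1) ^ 2) * (- y ^ 4 / 4) ^ S N) <= (1 / 4) ^ N.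
Proof.
  intros Hy.
  pose proof (shifted_square_pos y) as Hq.
  assert (Hy4 : 0 <= y ^ 4 <= 1).
  { split; [apply pow_le; lra|]. rewrite <- (pow1 4). apply pow_incr; lra. }
  rewrite Rabs_mult, <- RPow_abs.
  replace ((1 / 4) ^ N) with (4 * (1 / 4) ^ S N) by (simpl; field).
  apply Rmult_le_compat.
  - apply Rabs_pos.
  - apply pow_le, Rabs_pos.
  - rewrite Rabs_pos_eq by (apply Rlt_le, Rdiv_lt_0_compat; lra).
    apply Rle_div_l; nra.
  - apply pow_incr. split; [apply Rabs_pos|]. apply Rabs_le; lra.
Qed.

Lemma remainder_0 (N : nat) : remainder N 0 = - PI.
Proof.
  unfold remainder.
  replace (0 - 1) with (- (1)) by ring.
  rewrite atan_opp, atan_1.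
  assert (H0 : forall n, term_primitive n 0 = 0).
  { intros n. unfold term_primitive. rewrite !pow_i by lia. unfold Rdiv. ring. }
  rewrite (sum_n_ext _ (fun _ => 0) N H0), sum_n_const.
  field.
Qed.

Lemma remainder_1 (N : nat) :
  remainder N 1 =
  - sum_n (fun n => (-1) ^ n / 4 ^ n *
      (2 / (4 * INR n + 1) + 2 / (4 * INR n + 2) + 1 / (4 * INR n + 3))) N.
Proof.
  unfold remainder.
  replace (1 - 1) with 0 by ring.
  rewrite atan_0, Rmult_0_r, Rminus_0_l. f_equal.
  apply sum_n_ext. intros n. unfold term_primitive.
  now rewrite !pow1, Rmult_1_r.
Qed.

Lemma partial_sum_error (N : nat) :
  Rabs (PI - sum_n (fun n => (-1) ^ n / 4 ^ n *
      (2 / (4 * INR n + 1) + 2 / (4 * INR n + 2) + 1 / (4 * INR n + 3))) N)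
  <= (1 / 4) ^ N.
Proof.
  destruct (MVT_gen (remainder N) 0 1
              (fun y => 4 / (1 + (y - 1) ^ 2) * (- y ^ 4 / 4) ^ S N))
    as [c [Hc Heq]].
  - intros y _. apply is_derive_remainder.
  - intros y _. apply continuity_pt_filterlim.
    apply (ex_derive_continuous (remainder N)).
    eexists; apply is_derive_remainder.
  - rewrite Rmin_left, Rmax_right in Hc by lra.
    rewrite remainder_0, remainder_1, Rminus_0_r, Rmult_1_r in Heq.
    replace (PI - _) with (4 / (1 + (c - 1) ^ 2) * (- c ^ 4 / 4) ^ S N)
      by (rewrite <- Heq; ring).
    now apply remainder_derivative_bound.
Qed.

Theorem mainTheorem3 :
  is_series
    (fun n : nat =>
       (-1) ^ n / 4 ^ n *
       (2 / (4 * INR n + 1) + 2 / (4 * INR n + 2) + 1 / (4 * INR n + 3)))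
    PI.
Proof.
  assert (Hgeom : is_lim_seq (fun N => (1 / 4) ^ N) 0).
  { apply is_lim_seq_geom. rewrite Rabs_pos_eq; lra. }
  apply (is_lim_seq_le_le (fun N => PI - (1 / 4) ^ N) _
           (fun N => PI + (1 / 4) ^ N) PI).
  - intros N. apply Rabs_le_between'. rewrite Rabs_minus_sym.
    apply partial_sum_error.
  - replace (Finite PI) with (Finite (PI - 0)) by (f_equal; ring).
    apply is_lim_seq_minus'; [apply is_lim_seq_const | exact Hgeom].
  - replace (Finite PI) with (Finite (PI + 0)) by (f_equal; ring).
    apply is_lim_seq_plus'; [apply is_lim_seq_const | exact Hgeom].
Qed.
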